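(* Let $\eta\in(0,1/2)$. For all integers $d\ge2$, $N\ge1$ and every $\mathbf a\in\mathcal W$, the proportion of pairs $(\mathbf v_1,\mathbf v_2)\in\mathcal T_{\mathbf a,\mathcal W^2}$ satisfying $$\operatorname{dist}_d(\mathbf a,\mathbf v_1),\ \operatorname{dist}_d(\mathbf a,\mathbf v_2)\in\Bigl[\sqrt{B_{\mathbf a,\mathcal W}}-\tfrac1{d^\eta},\sqrt{B_{\mathbf a,\mathcal W}}+\tfrac1{d^\eta}\Bigr]\ \text{ and }\ \operatorname{dist}_d(\mathbf v_1,\mathbf v_2)\in\Bigl[\sqrt{\tfrac16+\tfrac1{3N}}-\tfrac1{d^\eta},\sqrt{\tfrac16+\tfrac1{3N}}+\tfrac1{d^\eta}\Bigr]$$ is at least $1-\dfrac{102}{5}\cdot\dfrac{1}{d^{1-2\eta}}$.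
   Context: $\mathcal W=\{0,1,\dots,N\}^d$. $\operatorname{dist}_d(\mathbf u,\mathbf v)=\frac{1}{\sqrt d\,N}\bigl(\sum_j(u_j-v_j)^2\bigr)^{1/2}$. $B_{\mathbf a,\mathcal W}=\frac{1}{\#\mathcal W}\sum_{\mathbf v\in\mathcal W}\operatorname{dist}_d^2(\mathbf a,\mathbf v)=\frac13+\frac1{6N}-\frac{a_1+\cdots+a_d}{dN}+\frac{a_1^2+\cdots+a_d^2}{dN^2}$. $\mathcal T_{\mathbf a,\mathcal W^2}\subset\mathcal W^2$ is the set of pairs $(\mathbf v_1,\mathbf v_2)$ of integer points which together with $\mathbf a$ form a non-degenerate triangle. *)

(* Defs.v *)
From mathcomp Require Import all_boot all_order all_algebra.
From mathcomp Require Import boolp reals exp.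

Set Implicit Arguments.
Unset Strict Implicit.
Unset Printing Implicit Defensive.

Import Order.TTheory GRing.Theory Num.Theory.
Local Open Scope ring_scope.

(* The lattice points of {0, ..., N}^d. *)
Notation cube d N := {ffun 'I_d -> 'I_N.+1}.

Section Defs.
Variables (R : realType) (d N : nat).
Implicit Types (x y z : 'rV[R]_d) (a v : cube d N).

Definition pt v : 'rV[R]_d := \row_j (v j : nat)%:R.

(* Normalised so that opposite vertices of the cube are at distance 1. *)
Definition ndist a v : R :=
  (Num.sqrt d%:R * N%:R)^-1 *
  Num.sqrt (\sum_j (pt a 0 j - pt v 0 j) ^+ 2).

Definition meansq a : R :=
  (#|{: cube d N}|%:R)^-1 * \sum_(v : cube d N) ndist a v ^+ 2.

Definition collinear x y z : Prop :=
  exists p u : 'rV[R]_d, u != 0 /\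
    exists r s t : R, [/\ x = p + r *: u, y = p + s *: u & z = p + t *: u].

Definition triangles a : {set cube d N * cube d N} :=
  [set v | ~~ `[< collinear (pt a) (pt v.1) (pt v.2) >]].

End Defs.

Arguments ndist R {d N} a v.
Arguments meansq R {d N} a.
Arguments triangles R {d N} a.

Definition proportion (R : realType) (T : finType) (A : {set T})
    (P : pred T) : R :=
  #|[set x in A | P x]|%:R / #|A|%:R.

(* Main.v *)
(** Pick v1, v2 uniformly and independently. Each of the three squared distances
    is the mean X of d independent [0, 1]-valued coordinates, so with B = E X we
    have Var X <= B / d. Since |sqrt X - sqrt B| > e forces (X - B)^2 >= e^2 B,
    Chebyshev's inequality bounds the probability of this event by 1 / (d e^2),
    and at most a proportion 3 / (d e^2) of all pairs violates one of the three
    conditions. If v1 != a, then the points v2 collinear with a and v1 are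
    determined by a coordinate where v1 and a differ, so with M = (N + 1)^d at
    most M + M (N + 1) <= 3/4 M^2 pairs are degenerate. The exceptional
    proportion among triangles is therefore at most 12 / (d e^2). *)

Require Import Defs.
From mathcomp Require Import all_boot all_order all_algebra.
From mathcomp Require Import boolp reals exp.
From mathcomp Require Import ring lra zify.

Set Implicit Arguments.
Unset Strict Implicit.
Unset Printing Implicit Defensive.

Import Order.TTheory GRing.Theory Num.Theory.
Local Open Scope ring_scope.

(** * Uniform averages over finite types *)

Definition avg (R : realType) (T : finType) (f : T -> R) : R :=
  #|T|%:R^-1 * \sum_x f x.

Section Average.
Variables (R : realType) (T : finType).
Implicit Types (f g : T -> R) (c : R).

Lemma eq_avg f g : f =1 g -> avg f = avg g.
Proof. by move=> fg; rewrite /avg (eq_bigr g) // => x _. Qed.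

Lemma avgD f g : avg (fun x => f x + g x) = avg f + avg g.
Proof. by rewrite /avg big_split mulrDr. Qed.

Lemma avgZ c f : avg (fun x => c * f x) = c * avg f.
Proof. by rewrite /avg -mulr_sumr mulrCA. Qed.

Lemma avg_sum (I : finType) (F : I -> T -> R) :
  avg (fun x => \sum_i F i x) = \sum_i avg (F i).
Proof. by rewrite /avg exchange_big mulr_sumr. Qed.

Lemma avg_cst c : (0 < #|T|)%N -> avg (fun _ : T => c) = c.
Proof.
move=> T0; rewrite /avg sumr_const -[X in _ * X]mulr_natl mulrA mulVf ?mul1r //.
by rewrite pnatr_eq0 -lt0n.
Qed.

Lemma avg_le f g : (forall x, f x <= g x) -> avg f <= avg g.
Proof. by move=> fg; rewrite ler_wpM2l ?invr_ge0 // ler_sum. Qed.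

Lemma avg_ge0 f : (forall x, 0 <= f x) -> 0 <= avg f.
Proof. by move=> f0; rewrite mulr_ge0 ?invr_ge0 // sumr_ge0. Qed.

End Average.

Lemma avg_pair (R : realType) (T U : finType) (f : T -> U -> R) :
  avg (fun x : T * U => f x.1 x.2) = avg (fun s => avg (f s)).
Proof.
rewrite /avg card_prod natrM invfM -(pair_big xpredT xpredT) /= -mulrA.
by rewrite [X in _ * X = _]mulr_sumr.
Qed.

Lemma avg_pair_fst (R : realType) (T : finType) (f : T -> R) :
  (0 < #|T|)%N -> avg (fun x : T * T => f x.1) = avg f.
Proof.
move=> T0; rewrite (avg_pair (fun s _ => f s)).
by apply: eq_avg => s; rewrite avg_cst.
Qed.

Lemma avg_pair_snd (R : realType) (T : finType) (f : T -> R) :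
  (0 < #|T|)%N -> avg (fun x : T * T => f x.2) = avg f.
Proof. by move=> T0; rewrite (avg_pair (fun _ s => f s)) avg_cst. Qed.

(** Independence of the coordinates of a uniform random function: distributivity turns a product of
    sums into a sum over functions, and the normalisation [#|T| ^ #|I|] splits into one factor per
    coordinate. *)
Lemma avg_ffun_prod (R : realType) (I T : finType) (F : I -> T -> R) :
  avg (fun v : {ffun I -> T} => \prod_k F k (v k)) = \prod_k avg (F k).
Proof.
rewrite /avg big_split /= prodr_const card_ffun natrX exprVn.
by rewrite bigA_distr_bigA.
Qed.

(** * Variance of a mean of independent coordinates *)

Section Concentration.
Variables (R : realType) (T : finType) (d : nat).
Hypothesis T_gt0 : (0 < #|T|)%N.
Let W : finType := {ffun 'I_d -> T}.

Lemma avg_pair_ffun_prod (F : 'I_d -> T -> T -> R) :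
  avg (fun v : W * W => \prod_k F k (v.1 k) (v.2 k)) =
  \prod_k avg (fun x : T * T => F k x.1 x.2).
Proof.
rewrite (avg_pair (fun v1 v2 : W => \prod_k F k (v1 k) (v2 k))).
under eq_avg do rewrite (avg_ffun_prod (fun k => F k _)).
rewrite (avg_ffun_prod (fun k s => avg (F k s))).
by apply: eq_bigr => k _; rewrite avg_pair.
Qed.

Lemma avg_coord (i : 'I_d) (f : T -> T -> R) :
  avg (fun v : W * W => f (v.1 i) (v.2 i)) = avg (fun x : T * T => f x.1 x.2).
Proof.
have TT0 : (0 < #|{: T * T}|)%N by rewrite card_prod muln_gt0 T_gt0.
(* Padding with the factor 1 at every coordinate other than [i] makes the product formula
   applicable. *)
transitivity (avg (fun v : W * W =>
    \prod_k (if k == i then f (v.1 k) (v.2 k) else 1))).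
  by apply: eq_avg => v; rewrite -big_mkcond big_pred1_eq.
rewrite (avg_pair_ffun_prod (fun k s t => if k == i then f s t else 1)).
rewrite (bigD1 i) //= eqxx big1 ?mulr1 // => k /negPf ->.
exact: avg_cst.
Qed.

Lemma avg_coord2 (i j : 'I_d) (f g : T -> T -> R) : i != j ->
  avg (fun v : W * W => f (v.1 i) (v.2 i) * g (v.1 j) (v.2 j)) =
  avg (fun x : T * T => f x.1 x.2) * avg (fun x : T * T => g x.1 x.2).
Proof.
move=> ij.
have TT0 : (0 < #|{: T * T}|)%N by rewrite card_prod muln_gt0 T_gt0.
pose F k s t := if k == i then f s t else if k == j then g s t else 1.
transitivity (avg (fun v : W * W => \prod_k F k (v.1 k) (v.2 k))).
  apply: eq_avg => v; rewrite (bigD1 i) //= (bigD1 j) 1?eq_sym //=.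
  rewrite /F eqxx eq_sym (negPf ij) eqxx big1 ?mulr1 // => k.
  by case/andP=> /negPf -> /negPf ->.
rewrite avg_pair_ffun_prod (bigD1 i) //= (bigD1 j) 1?eq_sym //=.
rewrite /F eqxx eq_sym (negPf ij) eqxx big1 ?mulr1 // => k.
by case/andP=> /negPf -> /negPf ->; rewrite avg_cst.
Qed.

(** The summand sees a coordinate of both points and also its index, so that one estimate covers the
    distance between two random points as well as the distance of either one to a fixed point. *)
Definition coord_mean (f : 'I_d -> T -> T -> R) (v : W * W) : R :=
  d%:R^-1 * \sum_j f j (v.1 j) (v.2 j).

Lemma avg_coord_mean (f : 'I_d -> T -> T -> R) :
  avg (coord_mean f) = d%:R^-1 * \sum_j avg (fun x : T * T => f j x.1 x.2).
Proof.
rewrite avgZ (avg_sum (fun j (v : W * W) => f j (v.1 j) (v.2 j))).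
by congr (_ * _); apply: eq_bigr => j _; exact: avg_coord.
Qed.

(* A [0, 1]-valued variable has second moment, hence variance, at most its
   mean; the factor [avg] on the right later cancels the one produced by
   passing to square roots, so that no lower bound on the mean is needed. *)
Lemma coord_mean_variance (f : 'I_d -> T -> T -> R) :
  (forall j s t, 0 <= f j s t <= 1) ->
  let B := avg (coord_mean f) in
  avg (fun v => (coord_mean f v - B) ^+ 2) <= B / d%:R.
Proof.
move=> f01 /=; rewrite avg_coord_mean.
have TT0 : (0 < #|{: T * T}|)%N by rewrite card_prod muln_gt0 T_gt0.
pose m j := avg (fun x : T * T => f j x.1 x.2).
pose g j s t := f j s t - m j.
have gavg j : avg (fun x : T * T => g j x.1 x.2) = 0.
  by rewrite avgD avg_cst // subrr.
have gvar j : avg (fun x : T * T => g j x.1 x.2 ^+ 2) <= m j.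
  have -> : avg (fun x : T * T => g j x.1 x.2 ^+ 2) =
            avg (fun x : T * T => f j x.1 x.2 ^+ 2) - m j ^+ 2.
    under eq_avg => x.
      rewrite (_ : _ ^+ 2 = f j x.1 x.2 ^+ 2 +
        ((- 2%:R * m j) * f j x.1 x.2 + m j ^+ 2)); last by rewrite /g; ring.
      over.
    by rewrite avgD avgD avgZ avg_cst // -/(m j); ring.
  apply: (@le_trans _ _ (avg (fun x : T * T => f j x.1 x.2 ^+ 2))).
    by rewrite lerBlDr lerDl sqr_ge0.
  apply: avg_le => x; have /andP[f0 f1] := f01 j x.1 x.2.
  by rewrite expr2 ler_piMl.
have -> : avg (fun v : W * W =>
      (coord_mean f v - d%:R^-1 * \sum_j m j) ^+ 2) =
    d%:R^-1 ^+ 2 * \sum_j avg (fun x : T * T => g j x.1 x.2 ^+ 2).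
  under eq_avg => v.
    rewrite /coord_mean -mulrBr -sumrB exprMn.
    rewrite [in X in _ * X]expr2 mulr_suml.
    under eq_bigr => i _ do rewrite mulr_sumr.
    over.
  rewrite avgZ; congr (_ * _).
  rewrite (avg_sum (fun i (v : W * W) => \sum_j
     (f i (v.1 i) (v.2 i) - m i) * (f j (v.1 j) (v.2 j) - m j))).
  apply: eq_bigr => i _.
  rewrite (avg_sum (fun j (v : W * W) =>
     (f i (v.1 i) (v.2 i) - m i) * (f j (v.1 j) (v.2 j) - m j))).
  (* In the expanded square only the diagonal survives: distinct coordinates are independent and
     each [g j] has mean 0. *)
  rewrite (bigD1 i) //= big1 ?addr0 => [|j ji].
    by rewrite -(avg_coord i (fun s t => g i s t ^+ 2)).
  by rewrite (@avg_coord2 i j (g i) (g j)) 1?eq_sym // gavg mul0r.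
rewrite [leRHS]mulrAC -expr2 ler_wpM2l ?sqr_ge0 //.
by apply: ler_sum => j _; exact: gvar.
Qed.

End Concentration.

(** * Chebyshev's inequality for square roots *)

Lemma chebyshev_sqrt (R : realType) (T : finType) (X : T -> R) (k e : R) :
  (0 < #|T|)%N -> (forall x, 0 <= X x) -> 0 < k -> 0 < e ->
  let B := avg X in
  avg (fun x => (X x - B) ^+ 2) <= B / k ->
  #|[set x | e < `|Num.sqrt (X x) - Num.sqrt B|]|%:R * (k * e ^+ 2)
    <= #|T|%:R.
Proof.
move=> T0 X0 k0 e0 B var.
have TR : 0 < #|T|%:R :> R by rewrite ltr0n.
have B0 : 0 <= B by exact: avg_ge0.
set A := [set x | _].
(* With [X x - B] factored as a difference of squares, the difference of the roots exceeds [e] in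
   absolute value and their sum is at least the root of [B]. *)
have AS x : x \in A -> e ^+ 2 * B <= (X x - B) ^+ 2.
  rewrite inE => eA.
  rewrite -[X x](sqr_sqrtr (X0 x)) -{2}(sqr_sqrtr B0) subr_sqr exprMn.
  rewrite -{1}(sqr_sqrtr B0) ler_pM ?sqr_ge0 //.
    by rewrite -[leRHS]real_normK ?num_real // ler_sqr ?nnegrE ?normr_ge0 ?ltW.
  by rewrite ler_sqr ?nnegrE ?addr_ge0 ?sqrtr_ge0 // lerDr sqrtr_ge0.
have sumle : \sum_x (X x - B) ^+ 2 <= #|T|%:R * (B / k).
  by rewrite -ler_pdivrMl.
(* For [B = 0] nothing can be cancelled, but then the variance bound is 0, which forces [X] to
   vanish everywhere and leaves [A] empty. *)
have [Bz|Bn] := eqVneq B 0.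
  suff -> : A = set0 by rewrite cards0 mul0r ltW.
  apply/setP => x; rewrite !inE; apply/negbTE; rewrite -leNgt.
  move: sumle; rewrite Bz mul0r mulr0 => sumle.
  have sx : (X x - 0) ^+ 2 <= 0.
    apply: le_trans sumle; rewrite (bigD1 x) //= lerDl sumr_ge0 // => y _.
    exact: sqr_ge0.
  have /eqP : (X x - 0) ^+ 2 == 0 by rewrite eq_le sx sqr_ge0.
  by move/eqP; rewrite sqrf_eq0 subr0 => /eqP ->; rewrite subrr normr0 ltW.
have Bp : 0 < B by rewrite lt_def Bn.
have : #|A|%:R * (e ^+ 2 * B) <= #|T|%:R * (B / k).
  apply: le_trans sumle; rewrite mulr_natl -sumr_const.
  apply: le_trans (ler_sum _ AS) _.
  rewrite [leRHS](bigID (mem A)) /= lerDl sumr_ge0 // => y _; exact: sqr_ge0.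
rewrite [X in _ <= X -> _]mulrA ler_pdivlMr // => h.
by rewrite -(ler_pM2r Bp); lra.
Qed.

(** * Moments of the uniform law on an integer interval *)

Lemma sum_ord_id (R : realType) (n : nat) :
  \sum_(s < n.+1) (s : nat)%:R = n%:R * (n%:R + 1) / 2%:R :> R.
Proof.
elim: n => [|n IH]; first by rewrite big_ord1 mul0r mul0r.
by rewrite big_ord_recr /= IH -natr1; field.
Qed.

Lemma sum_ord_sqr (R : realType) (n : nat) :
  \sum_(s < n.+1) (s : nat)%:R ^+ 2 =
  n%:R * (n%:R + 1) * (2%:R * n%:R + 1) / 6%:R :> R.
Proof.
elim: n => [|n IH]; first by rewrite big_ord1 expr0n /= !mul0r.
by rewrite big_ord_recr /= IH -natr1; field.
Qed.

(** The mean squared difference of two independent copies is twice the variance, here with mean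
    [N / 2] and second moment [N (2 N + 1) / 6]. This is where the constant under the root for the
    distance between [v1] and [v2] comes from. *)
Lemma avg_ord_dist_sqr (R : realType) (N : nat) : (0 < N)%N ->
  avg (fun x : 'I_N.+1 * 'I_N.+1 =>
    (((x.1 : nat)%:R - (x.2 : nat)%:R) / N%:R) ^+ 2) =
  1 / 6%:R + 1 / (3%:R * N%:R) :> R.
Proof.
move=> N0; have NR : N%:R != 0 :> R by rewrite pnatr_eq0 -lt0n.
have NR1 : N%:R + 1 != 0 :> R by rewrite natr1 pnatr_eq0.
rewrite (avg_pair (fun s t : 'I_N.+1 =>
  (((s : nat)%:R - (t : nat)%:R) / N%:R) ^+ 2 : R)).
have ord0 : (0 < #|'I_N.+1|)%N by rewrite card_ord.
have m1 : avg (fun s : 'I_N.+1 => (s : nat)%:R : R) = N%:R / 2%:R.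
  by rewrite /avg sum_ord_id card_ord -natr1; field.
have m2 : avg (fun s : 'I_N.+1 => (s : nat)%:R ^+ 2 : R) =
    N%:R * (2%:R * N%:R + 1) / 6%:R.
  by rewrite /avg sum_ord_sqr card_ord -natr1; field.
under eq_avg => s.
  under eq_avg => t.
    rewrite (_ : _ ^+ 2 = N%:R ^- 2 * ((s : nat)%:R ^+ 2 +
      (- 2%:R * (s : nat)%:R * (t : nat)%:R + (t : nat)%:R ^+ 2)));
      last by field.
    over.
  rewrite avgZ avgD avgD m2 avg_cst // avgZ m1.
  rewrite (_ : - 2%:R * _ * _ = - N%:R * (s : nat)%:R); last by field.
  over.
by rewrite avgZ avgD avgD m2 avg_cst // avgZ m1; field.
Qed.

(** * The normalised distance as the root of a coordinate mean *)

Lemma ndist_sqrt (R : realType) (d N : nat) (u v : cube d N) :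
  ndist R u v = Num.sqrt (d%:R^-1 *
    \sum_j (((u j : nat)%:R - (v j : nat)%:R) / N%:R) ^+ 2).
Proof.
rewrite /ndist; under [in RHS]eq_bigr do rewrite exprMn.
rewrite -mulr_suml mulrCA sqrtrM ?sumr_ge0 // => [|j _]; last exact: sqr_ge0.
rewrite sqrtrM ?invr_ge0 // sqrtrV // sqrtr_sqr ger0_norm ?invr_ge0 //.
rewrite invfM [RHS]mulrC; congr (_ * Num.sqrt _).
by apply: eq_bigr => j _; rewrite !mxE.
Qed.

Lemma ndist_sqr (R : realType) (d N : nat) (u v : cube d N) :
  ndist R u v ^+ 2 = d%:R^-1 *
    \sum_j (((u j : nat)%:R - (v j : nat)%:R) / N%:R) ^+ 2.
Proof.
rewrite ndist_sqrt sqr_sqrtr // mulr_ge0 ?invr_ge0 // sumr_ge0 // => j _.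
exact: sqr_ge0.
Qed.

Lemma ord_dist_sqr01 (R : realType) (N : nat) (s t : 'I_N.+1) :
  0 <= (((s : nat)%:R - (t : nat)%:R) / N%:R : R) ^+ 2 <= 1.
Proof.
rewrite sqr_ge0 /= -[leLHS]real_normK ?num_real // expr_le1 //.
rewrite normf_div [`|N%:R|]ger0_norm //.
(* For [N = 0] the quotient is 0, since the inverse of 0 is 0. *)
have [Nz|N0] := posnP N; first by rewrite [in _^-1]Nz invr0 mulr0.
rewrite ler_pdivrMr ?ltr0n // mul1r ler_norml.
have sN : (s : nat)%:R <= N%:R :> R by rewrite ler_nat -ltnS.
have tN : (t : nat)%:R <= N%:R :> R by rewrite ler_nat -ltnS.
have s0 : 0 <= (s : nat)%:R :> R by [].
have t0 : 0 <= (t : nat)%:R :> R by [].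
by apply/andP; split; lra.
Qed.

(** * Counting degenerate triangles *)

Lemma collinear_coord_inj (R : realType) (d N : nat) (a v w w' : cube d N) (j : 'I_d) :
  v j != a j -> w j = w' j ->
  collinear (pt R a) (pt R v) (pt R w) ->
  collinear (pt R a) (pt R v) (pt R w') -> w = w'.
Proof.
(* Both [u - a] and [v - a] are multiples of the direction [q], so their 2 by 2 minors vanish. As
   [v j] differs from [a j], the value [u j] then determines every [u k]. *)
have cross u : collinear (pt R a) (pt R v) (pt R u) -> forall k,
    ((u k : nat)%:R - (a k : nat)%:R) * ((v j : nat)%:R - (a j : nat)%:R) =
    ((u j : nat)%:R - (a j : nat)%:R) * ((v k : nat)%:R - (a k : nat)%:R) :> R.
  case=> p [q [_ [r [s [t [/rowP ea /rowP ev /rowP eu]]]]]] k.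
  move: (ea k) (ev k) (eu k) (ea j) (ev j) (eu j); rewrite !mxE.
  by move=> -> -> -> -> -> ->; ring.
move=> vj ej /cross cw /cross cw'; apply/ffunP => k; apply/val_inj/eqP.
rewrite -(eqr_nat R).
have vR : (v j : nat)%:R - (a j : nat)%:R != 0 :> R.
  by rewrite subr_eq0 eqr_nat.
have /(mulIf vR)/eqP : ((w k : nat)%:R - (a k : nat)%:R) *
    ((v j : nat)%:R - (a j : nat)%:R) = ((w' k : nat)%:R - (a k : nat)%:R) *
    ((v j : nat)%:R - (a j : nat)%:R) :> R by rewrite cw cw' ej.
by rewrite (inj_eq (addIr _)).
Qed.

Lemma card_collinear_le (R : realType) (d N : nat) (a v : cube d N) : v != a ->
  (#|[set w : cube d N | `[< collinear (pt R a) (pt R v) (pt R w) >]]|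
    <= N.+1)%N.
Proof.
move=> va; have [j vj] : exists j, v j != a j.
  apply/existsP; apply: contraNT va; rewrite negb_exists => /forallP h.
  by apply/eqP/ffunP => j; apply/eqP; move: (h j); rewrite negbK.
rewrite -[leqRHS]card_ord -(card_in_imset (f := fun w : cube d N => w j)).
  exact: max_card.
move=> w w'; rewrite !inE => /asboolP cw /asboolP cw' e.
exact: collinear_coord_inj vj e cw cw'.
Qed.

Lemma card_triangles_ge (R : realType) (d N : nat) (a : cube d N) :
  (2 <= d)%N -> (1 <= N)%N ->
  (#|{: cube d N * cube d N}| <= 4 * #|triangles R a|)%N.
Proof.
move=> d2 N1; set M := #|{: cube d N}|.
(* One factor [N + 1] of [(N + 1) ^ 2] is at least 2, and [d] is at least 2. *)
have MN : (2 * N.+1 <= M)%N.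
  rewrite /M card_ffun !card_ord; apply: (@leq_trans (N.+1 ^ 2)).
    by rewrite expnS expn1 leq_mul2r.
  by rewrite leq_pexp2l.
rewrite card_prod -/M.
have : (#|~: triangles R a| <= M + M * N.+1)%N.
  pose C (v : cube d N) := [set w : cube d N | `[< collinear (pt R a) (pt R v) (pt R w) >]].
  have -> : #|~: triangles R a| = (\sum_(v : cube d N) #|C v|)%N.
    rewrite -sum1_card (eq_bigl (fun v : cube d N * cube d N =>
      xpredT v.1 && (v.2 \in C v.1))); last by move=> v; rewrite !inE negbK.
    rewrite -(pair_big_dep xpredT (fun v w => w \in C v) (fun _ _ => 1%N)) /=.
    by apply: eq_bigr => v _; rewrite sum1_card.
  (* The term [v = a] gets the trivial bound [M]; each other term is at most [N + 1]. *)
  rewrite (bigD1 a) //= leq_add ?max_card //.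
  apply: (@leq_trans (\sum_(v : cube d N | v != a) N.+1)%N).
    by apply: leq_sum => v; exact: card_collinear_le.
  by rewrite sum_nat_const leq_mul2r max_card orbT.
(* After division by [M] the claim is [4 (N + 2) <= 3 M], which follows from
   [4 (N + 2) <= 6 (N + 1) <= 3 M], the first step by [N >= 1]. *)
by move: (cardsC (triangles R a)); rewrite card_prod -/M; nia.
Qed.

(** * From concentration to the three distance conditions *)

Lemma sqrt_coord_mean_concentration (R : realType) (T : finType) (d : nat)
    (e : R) (X : {ffun 'I_d -> T} * {ffun 'I_d -> T} -> R)
    (f : 'I_d -> T -> T -> R) :
  (0 < #|T|)%N -> (0 < d)%N -> 0 < e ->
  (forall j s t, 0 <= f j s t <= 1) ->
  (forall v, X v = Num.sqrt (coord_mean f v)) ->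
  #|[set v | X v \notin `[Num.sqrt (avg (coord_mean f)) - e,
                          Num.sqrt (avg (coord_mean f)) + e]]|%:R
    * (d%:R * e ^+ 2) <= #|{: {ffun 'I_d -> T} * {ffun 'I_d -> T}}|%:R :> R.
Proof.
move=> T0 d0 e0 f01 XE.
have W0 : (0 < #|{: {ffun 'I_d -> T} * {ffun 'I_d -> T}}|)%N.
  by rewrite card_prod card_ffun muln_gt0 expn_gt0 T0.
have mean_ge0 v : 0 <= coord_mean f v.
  rewrite mulr_ge0 ?invr_ge0 // sumr_ge0 // => j _.
  by case/andP: (f01 j (v.1 j) (v.2 j)).
have := chebyshev_sqrt W0 mean_ge0 _ e0 (coord_mean_variance T0 f01).
rewrite ltr0n => /(_ d0); congr (_%:R * _ <= _); apply: eq_card => v.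
by rewrite !in_set XE in_itv /= -ler_distl -ltNge.
Qed.

Theorem theorem6p3 (R : realType) (eta : R) (eta_gt0 : 0 < eta)
    (eta_lt : eta < 1 / 2%:R) (d N : nat) (d_ge2 : (2 <= d)%N)
    (N_ge1 : (1 <= N)%N) (a : cube d N) :
  let e : R := 1 / (d%:R `^ eta) in
  let b : R := Num.sqrt (meansq R a) in
  let c : R := Num.sqrt (1 / 6%:R + 1 / (3%:R * N%:R)) in
  1 - 102%:R / 5%:R * (1 / (d%:R `^ (1 - 2%:R * eta))) <=
  proportion R (triangles R a)
    (fun v => [&& ndist R a v.1 \in `[b - e, b + e],
                  ndist R a v.2 \in `[b - e, b + e] &
                  ndist R v.1 v.2 \in `[c - e, c + e]]).
Proof.
cbv zeta; set e := 1 / d%:R `^ eta; set b := Num.sqrt (meansq R a).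
set c := Num.sqrt (1 / 6%:R + _).
have d0 : (0 < d)%N by exact: leq_trans d_ge2.
have dR : 0 < d%:R :> R by rewrite ltr0n.
have e0 : 0 < e by rewrite divr_gt0 // powR_gt0.
(* The power of [d] in the error term is exactly the Chebyshev factor for the half-width [e]. *)
have dE : d%:R `^ (1 - 2%:R * eta) = d%:R * e ^+ 2.
  rewrite powRB ?(gt_eqF dR) ?implybT // powRr1 ?ltW // [2%:R * _]mulrC powRrM.
  by rewrite powR_mulrn ?powR_ge0 // /e div1r exprVn.
set E := d%:R * e ^+ 2 in dE.
have E0 : 0 < E by rewrite mulr_gt0 // exprn_gt0.
have W0 : (0 < #|{: cube d N}|)%N by rewrite card_ffun expn_gt0 card_ord.
pose D (s t : 'I_N.+1) : R := (((s : nat)%:R - (t : nat)%:R) / N%:R) ^+ 2.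
have bE (v : cube d N) : ndist R a v ^+ 2 = d%:R^-1 * \sum_j D (a j) (v j).
  exact: ndist_sqr.
(* A function of one component has the same average over pairs as over points, which identifies
   [meansq] with the mean around which the concentration bound is centred. *)
have b1E : b = Num.sqrt (avg (coord_mean (fun j s _ => D (a j) s))).
  congr Num.sqrt; rewrite /meansq -/(avg _) -avg_pair_fst //.
  by apply: eq_avg => v; rewrite bE.
have b2E : b = Num.sqrt (avg (coord_mean (fun j _ t => D (a j) t))).
  congr Num.sqrt; rewrite /meansq -/(avg _) -avg_pair_snd //.
  by apply: eq_avg => v; rewrite bE.
have cE : c = Num.sqrt (avg (coord_mean (fun _ : 'I_d => D))).
  congr Num.sqrt; rewrite avg_coord_mean ?card_ord // avg_ord_dist_sqr //.
  rewrite sumr_const card_ord -[X in _ = _ * X]mulr_natl mulrA mulVf ?mul1r //.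
  by rewrite gt_eqF.
set T := triangles R a; set P := (X in proportion _ _ X); rewrite dE.
pose M : R := #|{: cube d N * cube d N}|%:R.
pose B1 := [set v : cube d N * cube d N | ndist R a v.1 \notin `[b - e, b + e]].
pose B2 := [set v : cube d N * cube d N | ndist R a v.2 \notin `[b - e, b + e]].
pose B3 := [set v : cube d N * cube d N | ndist R v.1 v.2 \notin `[c - e, c + e]].
have h1 : #|B1|%:R * E <= M.
  rewrite /B1 b1E; apply: sqrt_coord_mean_concentration => // [|j s t|v].
    by rewrite card_ord.
    exact: ord_dist_sqr01.
  exact: ndist_sqrt.
have h2 : #|B2|%:R * E <= M.
  rewrite /B2 b2E; apply: sqrt_coord_mean_concentration => // [|j s t|v].
    by rewrite card_ord.
    exact: ord_dist_sqr01.
  exact: ndist_sqrt.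
have h3 : #|B3|%:R * E <= M.
  rewrite /B3 cE; apply: sqrt_coord_mean_concentration => // [|j s t|v].
    by rewrite card_ord.
    exact: ord_dist_sqr01.
  exact: ndist_sqrt.
have MT : M <= 4%:R * #|T|%:R.
  by rewrite -natrM ler_nat; exact: card_triangles_ge.
(* Positivity makes the division in [proportion] a genuine one; the quarter bound supplies it. *)
have T0 : 0 < #|T|%:R :> R.
  have : 0 < M by rewrite ltr0n card_prod muln_gt0 W0.
  by lra.
(* Union bound: a triangle outside the good set violates one of the three conditions. *)
have split : #|T|%:R <= #|[set v in T | P v]|%:R + #|B1|%:R + #|B2|%:R + #|B3|%:R :> R.
  rewrite -!natrD ler_nat.
  apply: (@leq_trans #|[set v in T | P v] :|: B1 :|: B2 :|: B3|).
    apply: subset_leq_card; apply/subsetP => v vT.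
    rewrite !in_setU [v \in [set _ in _ | _]]in_set vT !in_set /P /=.
    by do 3 case: (_ \in _).
  do 2 (apply: leq_trans (leq_card_setU _ _) _; rewrite leq_add2r).
  exact: leq_card_setU.
rewrite /proportion ler_pdivlMr // mulrBl !mul1r lerBlDr mulrAC.
(* The three bad sets, each scaled by [E], total at most [3 M], hence at most [12 #|T|], and 12 is
   below 102/5. *)
apply: le_trans split _; rewrite -!addrA lerD2l ler_pdivlMr //.
by lra.
Qed.
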